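(* Let $G$ be a finite simple connected graph without isolated vertices (i.e. with at least one edge), and let $I(G)$ be its edge ideal. Then \[ \min\{t\ge 1 \mid \text{there exists a minimal prime } P \text{ of } I(G) \text{ such that } v_P(I(G)^t)=2t-1\}=\kappa(G). \]
   Context: Let $G$ be a finite simple graph on $V(G)=\{1,\dots,n\}$, $\mathrm{k}$ a field and $S=\mathrm{k}[x_1,\dots,x_n]$. The edge ideal is $I(G)=(x_ix_j\mid\{i,j\}\in E(G))\subseteq S$. For an ideal $I$ of $S$ and $P\in\operatorname{Ass}(I)$ (associated primes of $S/I$), $v_P(I)=\min\{\deg f\mid f\in S,\ I:f=P\}$. For $X\subseteq V(G)$, $N_G(X)$ is the set of all neighbors of vertices in $X$. $G^2$ is the graph on $V(G)$ in which two distinct vertices are adjacent iff their distance in $G$ is at most $2$, and $G^2[X]$ is its induced subgraph on $X$. A (vertex) cover of $G$ is a subset of $V(G)$ meeting every edge. Define \[ \kappa(G)=\min\{|X| \mid X\subseteq V(G)\text{ is an independent set of }G,\ G^2[X]\text{ is connected, and }N_G(X)\text{ is a cover of }G\}. \] *)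

(* Defs.v *)
From mathcomp Require Import all_boot all_order all_algebra.
From mathcomp Require Import boolp classical_sets.
From mathcomp Require Import mpoly.

Set Implicit Arguments.
Unset Strict Implicit.
Unset Printing Implicit Defensive.

Import GRing.Theory.
Local Open Scope ring_scope.
Local Open Scope classical_set_scope.

Definition is_min (A : set nat) (m : nat) : Prop :=
  A m /\ forall j : nat, A j -> (m <= j)%N.

(* A simple graph on a finite type T is a symmetric irreflexive e : rel T. *)
Definition connected (T : finType) (e : rel T) : Prop :=
  forall x y : T, connect e x y.

Section Graphs.
Variable T : finType.
Implicit Types (e : rel T) (X C : {set T}).

Definition induced e (X : {set T}) : rel {x : T | x \in X} := relpre val e.
Arguments induced : clear implicits.

(* distance at most d, i.e. there is a walk of length m <= d from x to y *)
Definition dist_le e (d : nat) (x y : T) : bool :=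
  [exists m : 'I_d.+1, [exists p : m.-tuple T, path e x p && (last x p == y)]].

Definition square e : rel T := [rel x y | (x != y) && dist_le e 2 x y].

Definition neighbors e X : {set T} := [set y | [exists x in X, e x y]]%SET.

Definition vertex_cover e C : Prop :=
  forall x y, e x y -> (x \in C) || (y \in C).

Definition independent e X : Prop := {in X &, forall x y, ~~ e x y}.

Definition is_kappa e (m : nat) : Prop :=
  is_min [set j | exists X : {set T},
            [/\ #|X| = j, independent e X,
                connected (induced (square e) X)
              & vertex_cover e (neighbors e X)]] m.

End Graphs.

Section Ideals.
Variable R : comNzRingType.
Implicit Types (A I P : set R) (f : R).

Definition ideal_gen A : set R :=
  [set f | exists (m : nat) (c a : 'I_m -> R),
     (forall i, A (a i)) /\ f = \sum_(i < m) c i * a i].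

Definition ideal_exp I (t : nat) : set R :=
  ideal_gen [set f | exists2 g : 'I_t -> R, forall i, I (g i)
                                          & f = \prod_(i < t) g i].

Definition colon I f : set R := [set g | I (g * f)].

(* idealr_closed already requires the ideal to be proper. *)
Definition prime_ideal P : Prop :=
  idealr_closed (mem P) /\ prime_idealr_closed (mem P).

Definition minimal_prime I P : Prop :=
  [/\ prime_ideal P, I `<=` P
    & forall Q : set R, prime_ideal Q -> I `<=` Q -> Q `<=` P -> Q = P].

End Ideals.

Definition edge_ideal (k : fieldType) (n : nat) (e : rel 'I_n) :
    set {mpoly k[n]} :=
  ideal_gen [set f | exists i j : 'I_n, e i j /\ f = 'X_i * 'X_j].
Arguments edge_ideal k {n} e.

(* v_P(I) = d. Here msize f = d.+1 means that f is nonzero of total degree d;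
   for a prime P, a witness f also shows that P is associated to I, and it
   cannot be 0 because P is proper. *)
Definition is_vnumber (k : fieldType) (n : nat) (P I : set {mpoly k[n]})
    (d : nat) : Prop :=
  is_min [set j | exists2 f : {mpoly k[n]}, msize f = j.+1 & colon I f = P] d.

(* Main.v *)
Require Import Defs.
From mathcomp Require Import all_boot all_order all_algebra.
From mathcomp Require Import boolp classical_sets.
From mathcomp Require Import mpoly zify.

(** Write I for the edge ideal. Since I^t is generated in degree 2t and a
prime P containing I contains some variable z, any nonzero f with
I^t : f = P satisfies 2t <= deg (z f), so that 2t - 1 is the least value
v_P(I^t) could take ([colon_degree_ge]). Each set X as in the definition of
kappa shows that this value is reached for t = |X|, and conversely each t for
which it is reached yields such a set X with |X| <= t.

If X is independent, G^2[X] is connected, N(X) is a cover and |X| = t, add the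
vertices of X one at a time, each new vertex x' having a common neighbor y with
an earlier vertex. The product m of all these x' and y (and of the first vertex)
has degree 2t - 1, and z m is a product of t edges for each z in N(X): pair z
with a vertex of X, and shift the y's along the way back to the first vertex
([witness_of_dominating]). On the other hand m has only t - 1 factors in the
cover N(X), so no product of m with variables outside N(X) lies in I^t. Hence
I^t : m is the minimal prime generated by N(X) ([vnumber_of_dominating]).

Conversely let I^t : f = P with f of degree 2t - 1, and let C be the minimal
vertex cover of the variables in P. Some monomial m of f has at most t - 1
factors in C: otherwise each monomial of f has t factors in C, which can be
paired with neighbors outside C, and a power of the product of the variables
outside C multiplies f into I^t and hence lies in P, which contains none of
these variables ([colon_small_cover_degree]). For z in C the monomial z m is
then a product of exactly t edges, so m has t factors outside C. Let X be the
set of these factors, |X| <= t. For A inside X and z in C not adjacent to A, the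
edges in z m match the factors of m in A with factors of m in N(A), so that
deg_A m <= deg_(N(A)) m. For A = X this reads t <= t - 1, so no z in C avoids
N(X), and N(X) = C is a cover. If G^2[X] split into parts A and B, then N(A) and N(B)
would be disjoint, and a vertex z of N(B) used for A together with one of N(A)
used for B would again give t <= t - 1 ([dominating_of_witness]).

That sets X as in the definition of kappa exist at all is shown by taking one
of maximal size among the independent sets with connected square
([exists_connected_dominating]). *)

Set Implicit Arguments.
Unset Strict Implicit.
Unset Printing Implicit Defensive.

(** * Connected induced subgraphs of the square *)

Lemma connect_cut (T : finType) (r : rel T) (a : pred T) x y :
  connect r x y -> a x -> ~~ a y -> exists u v, [/\ r u v, a u & ~~ a v].
Proof.
case/connectP=> p; elim: p x => [|z p IHp] x /=; first by move=> _ -> ->.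
case/andP=> rxz zp y_last ax nay; have [az|naz] := boolP (a z).
  exact: IHp zp y_last az nay.
by exists x, z.
Qed.

Section Graphs.
Import fintype boot.finset.
Variable T : finType.
Implicit Types (r e : rel T) (A X : {set T}).

(** Turns connectedness over a subtype into a statement about subsets of T, the
form in which it is both used and established below. *)
Lemma connected_inducedP r X :
  connected (induced r (X:=X)) <->
  forall A, A \proper X -> A != set0 ->
    exists u v, [/\ u \in A, v \in X, v \notin A & r u v].
Proof.
split=> [conn A /properP[/subsetP sAX [y Xy nAy]] /set0Pn[x Ax]|cut x y].
  pose a := [pred z : {z | z \in X} | val z \in A].
  have [u [v [ruv /= Au nAv]]] :=
    @connect_cut _ (induced r (X:=X)) a
      (exist _ x (sAX x Ax)) (exist _ y Xy) (conn _ _) Ax nAy.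
  by exists (val u), (val v); split=> //; apply: valP.
pose A := [set val z | z in [pred z | connect (induced r (X:=X)) x z]]%SET.
have sAX : A \subset X by apply/subsetP=> _ /imsetP[z _ ->]; apply: valP.
have Ax : val x \in A by apply: imset_f; apply: connect0.
have [/eqP AX|nAX] := boolP (A == X).
  have : val y \in A by rewrite AX; apply: valP.
  by case/imsetP=> z xz /val_inj ->.
have A0 : A != set0 by apply/set0Pn; exists (val x).
have [|_ [v [/imsetP[u xu ->] Xv nAv ruv]]] := cut A _ A0.
  by rewrite properEneq nAX.
case/negP: nAv; apply/imsetP; exists (exist _ v Xv) => //.
by rewrite inE; apply: connect_trans xu (connect1 _).
Qed.

Lemma neighborsP e X y :
  reflect (exists2 x, x \in X & e x y) (y \in neighbors e X).
Proof. by rewrite inE; apply: (iffP exists_inP). Qed.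

Lemma squareP e x y :
  reflect (x != y /\ (e x y \/ exists2 z, e x z & e z y)) (square e x y).
Proof.
apply: (iffP andP) => -[xNy H]; split=> //.
  case/existsP: H => -[m lem] /existsP[[p /= /eqP sz_p] /andP[]].
  case: p sz_p => [|a [|b [|c p]]] //=.
  - by move=> _ _ /eqP xy; rewrite xy eqxx in xNy.
  - by move=> _ /[swap] /eqP -> /andP[]; left.
  - by move=> _ /[swap] /eqP -> /and3P[]; right; exists a.
  by move=> def_m; move: lem; rewrite -def_m.
case: H => [exy|[z exz ezy]].
  apply/existsP; exists (inord 1); rewrite inordK //.
  by apply/existsP; exists [tuple y]; rewrite /= exy eqxx.
apply/existsP; exists (inord 2); rewrite inordK //.
by apply/existsP; exists [tuple z; y]; rewrite /= exz ezy eqxx.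
Qed.

Variable e : rel T.
Hypotheses (e_sym : ssrbool.symmetric e) (e_irr : irreflexive e).

Lemma square_sym : ssrbool.symmetric (square e).
Proof.
have imp x y : square e x y -> square e y x.
  case/squareP=> xNy H; apply/squareP; split; first by rewrite eq_sym.
  case: H => [exy|[z xz zy]]; [by left; rewrite e_sym | right].
  by exists z; rewrite e_sym.
by move=> x y; apply/idP/idP; apply: imp.
Qed.

(** In a maximal independent set X with connected square, every vertex is in X or
adjacent to X: otherwise some edge u v leaves X and its neighborhood at a
neighbor u of X, and v can be added to X. An edge inside the complement of N(X)
would then be an edge inside X. *)
Lemma exists_connected_dominating : connected e -> (exists i j, e i j) ->
  exists X, [/\ independent e X, connected (induced (square e) (X:=X))
              & vertex_cover e (neighbors e X)].
Proof.
move=> e_conn [x0 _].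
pose good X := [/\ X != set0, independent e X
                 & connected (induced (square e) (X:=X))].
have good1 : `[< good [set x0]%SET >].
  apply/asboolP; split.
  - by apply/set0Pn; exists x0; rewrite inE.
  - by move=> x y /set1P-> /set1P->; rewrite e_irr.
  by move=> [x /[dup] /set1P x_x0 x0x] [y /[dup] /set1P y_x0 x0y];
     apply: eq_connect0; apply: val_inj; rewrite /= x_x0 y_x0.
case: (@arg_maxnP _ _ (fun X => `[< good X >]) (fun X => #|X|) good1) => X /asboolP[].
move=> X0 indX connX maxX; exists X; split=> //.
have dom y : y \in X :|: neighbors e X.
  apply/negPn/negP=> nXy; case/set0Pn: (X0) => x Xx.
  have [|u [v [euv]]] := @connect_cut _ e (mem (X :|: neighbors e X)%SET)
    x y (e_conn x y) _ nXy; first by rewrite !inE Xx.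
  rewrite !inE negb_or => Nu /andP[nXv /exists_inP Nv].
  have {}Nu : u \in neighbors e X.
    by case/orP: Nu => [Xu|]; [case: Nv; exists u | rewrite inE].
  have [w Xw ewu] := neighborsP _ _ _ Nu.
  have sq_wv : square e w v.
    apply/squareP; split; last by right; exists u.
    by apply: contraNneq nXv => <-.
  have: #|v |: X| <= #|X|; last by rewrite cardsU1 nXv add1n ltnn.
  apply: maxX; apply/asboolP; split.
  - by apply/set0Pn; exists v; rewrite !inE eqxx.
  - move=> a b /setU1P[->|Xa] /setU1P[->|Xb].
    + by rewrite e_irr.
    + by rewrite e_sym; apply/negP=> ebv; apply: Nv; exists b.
    + by apply/negP=> eav; apply: Nv; exists a.
    exact: indX.
  apply/connected_inducedP=> A /properP[/subsetP sA [b]] bX bA A0.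
  have [Av|nAv] := boolP (v \in A); last first.
    have sAX : A \subset X.
      apply/subsetP=> a Aa; case/setU1P: (sA a Aa) => // av.
      by rewrite -av Aa in nAv.
    have [pAX|] := boolP (A \proper X).
      have [||p [q [Ap Xq Aq pq]]] := (connected_inducedP _ _).1 connX A => //.
      by exists p, q; rewrite inE Xq orbT.
    rewrite properEneq sAX andbT negbK => /eqP AX.
    by exists w, v; rewrite AX Xw nXv sq_wv !inE eqxx.
  have [Aw|nAw] := boolP (w \in A); last first.
    by exists v, w; rewrite Av nAw square_sym sq_wv !inE Xw orbT.
  have Xb : b \in X by case/setU1P: bX => // bv; rewrite bv Av in bA.
  have [||p [q [/setIP[Ap Xp] Xq Aq pq]]] :=
    (connected_inducedP _ _).1 connX (A :&: X)%SET.
  - apply/properP; split; first exact: subsetIr.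
    by exists b => //; rewrite inE (negbTE bA).
  - by apply/set0Pn; exists w; rewrite inE Aw.
  by exists p, q; rewrite Ap !inE Xq orbT pq; move: Aq; rewrite inE Xq andbT.
move=> a b eab; have: a \in X :|: neighbors e X := dom a.
case/setUP=> [Xa|->//]; apply/orP; right.
by apply/neighborsP; exists a.
Qed.

End Graphs.

(** * Monomials that are multiples of a product of edges *)

Section Monomials.
Import fintype boot.finset.
Variable n : nat.
Implicit Types (A C X : {set 'I_n}) (m : 'X_{1..n}) (s : seq ('I_n * 'I_n)).

Lemma mnm_le_mdeg_eq m1 m2 : (m1 <= m2)%MM -> mdeg m2 <= mdeg m1 -> m1 = m2.
Proof.
move=> le12; rewrite -{1}(submK le12) mdegD -{2}[mdeg m1]add0n leq_add2r leqn0.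
by rewrite mdeg_eq0 => /eqP eq0; rewrite -[RHS](submK le12) eq0 add0m.
Qed.

Definition wdeg A m := (\sum_(i in A) m i)%N.

Lemma wdegD A m1 m2 : wdeg A (m1 + m2)%MM = wdeg A m1 + wdeg A m2.
Proof. by rewrite /wdeg -big_split; apply: eq_bigr => i _; rewrite mnmDE. Qed.

Lemma wdeg0 A : wdeg A 0%MM = 0.
Proof. by apply: big1 => i _; rewrite mnm0E. Qed.

Lemma wdeg1 A i : wdeg A U_(i)%MM = (i \in A).
Proof.
rewrite /wdeg big_mkcond (bigD1 i) //= big1 ?mnm1E ?eqxx ?addn0; first by case: ifP.
by move=> j /negbTE ji; rewrite mnm1E eq_sym ji if_same.
Qed.

Lemma wdeg_le A m1 m2 : (m1 <= m2)%MM -> wdeg A m1 <= wdeg A m2.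
Proof. by move/mnm_lepP=> le12; apply: leq_sum => i _; apply: le12. Qed.

Lemma wdegT m C : mdeg m = wdeg C m + wdeg (~: C) m.
Proof.
rewrite mdegE (bigID (mem C)) /=; congr (_ + _).
by apply: eq_bigl => i; rewrite inE.
Qed.

Lemma wdeg_sub A C m : A \subset C -> wdeg A m <= wdeg C m.
Proof.
move/subsetP=> sAC; rewrite /wdeg big_mkcond [leqRHS]big_mkcond /=.
by apply: leq_sum => i _; case: ifP => [/sAC->|].
Qed.

Lemma wdegU A C m : [disjoint A & C] -> wdeg (A :|: C) m = wdeg A m + wdeg C m.
Proof. by move=> dis; rewrite /wdeg -bigU //; apply: eq_bigl => i; rewrite !inE. Qed.

Lemma wdeg_gt0 C m : (0 < wdeg C m) = [exists z in C, m z != 0].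
Proof.
rewrite lt0n sum_nat_eq0 negb_forall; apply: eq_existsb => z.
by rewrite negb_imply.
Qed.

Variable e : rel 'I_n.

Definition edge_sum s : 'X_{1..n} := (\sum_(p <- s) (U_(p.1) + U_(p.2)))%MM.

Definition edge_multiple t m := exists s,
  [/\ size s = t, all (fun p => e p.1 p.2) s & (edge_sum s <= m)%MM].

Lemma edge_sum_cons p s :
  edge_sum (p :: s) = (U_(p.1) + U_(p.2) + edge_sum s)%MM.
Proof. exact: big_cons. Qed.

Lemma mdeg_edge_sum s : mdeg (edge_sum s) = 2 * size s.
Proof.
elim: s => [|p s IHs]; first by rewrite /edge_sum big_nil mdeg0.
by rewrite edge_sum_cons !mdegD !mdeg1 IHs mulnS.
Qed.

Lemma edge_multiple_le t m1 m2 :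
  (m1 <= m2)%MM -> edge_multiple t m1 -> edge_multiple t m2.
Proof.
by move=> le12 [s [sz es les]]; exists s; split=> //; apply: lepm_trans le12.
Qed.

Lemma edge_multiple0 m : edge_multiple 0 m.
Proof.
exists [::]; split=> //; rewrite /edge_sum big_nil.
by apply/mnm_lepP=> i; rewrite mnm0E.
Qed.

Lemma edge_multipleD t1 t2 m1 m2 : edge_multiple t1 m1 -> edge_multiple t2 m2 ->
  edge_multiple (t1 + t2) (m1 + m2)%MM.
Proof.
move=> [s1 [<- es1 le1]] [s2 [<- es2 le2]]; exists (s1 ++ s2).
rewrite size_cat all_cat es1 es2; split=> //.
rewrite /edge_sum big_cat; apply/mnm_lepP=> i; rewrite !mnmDE.
by apply: leq_add; apply/mnm_lepP.
Qed.

Lemma edge_multiple1 i j : e i j -> edge_multiple 1 (U_(i) + U_(j))%MM.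
Proof.
move=> eij; exists [:: (i, j)]; rewrite /= eij; split=> //.
by rewrite /edge_sum big_seq1; apply: lepm_refl.
Qed.

Lemma edge_multiple_mdeg t m : edge_multiple t m -> 2 * t <= mdeg m.
Proof.
by move=> [s [<- _ le_s]]; rewrite -mdeg_edge_sum -(submK le_s) mdegD leq_addl.
Qed.

Lemma edge_multiple_exact t m : mdeg m <= 2 * t -> edge_multiple t m ->
  exists2 s, all (fun p => e p.1 p.2) s & m = edge_sum s.
Proof.
move=> deg_m [s [sz_s es le_s]]; exists s => //.
by rewrite (mnm_le_mdeg_eq le_s) // mdeg_edge_sum sz_s.
Qed.

(** Every edge has an end in the cover C. *)
Lemma edge_multiple_wdeg C t m :
  vertex_cover e C -> edge_multiple t m -> t <= wdeg C m.
Proof.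
move=> covC [s [<- es le_s]]; apply: leq_trans (wdeg_le C le_s).
elim: s es {le_s} => [|p s IHs] //= /andP[ep es]; rewrite edge_sum_cons.
rewrite !wdegD !wdeg1 -add1n leq_add ?IHs //.
by case/orP: (covC _ _ ep) => ->; rewrite ?addn1.
Qed.

Hypotheses (e_sym : ssrbool.symmetric e).

(** An edge with an end in the independent set A has its other end in N(A). *)
Lemma wdeg_edge_sum_neighbors A s : independent e A ->
  all (fun p => e p.1 p.2) s ->
  wdeg A (edge_sum s) <= wdeg (neighbors e A) (edge_sum s).
Proof.
move=> indA; elim: s => [|[x y] s IHs] /=; first by rewrite /edge_sum big_nil !wdeg0.
case/andP=> exy es; rewrite edge_sum_cons !wdegD !wdeg1 leq_add ?IHs //=.
have Ny : x \in A -> y \in neighbors e A by move=> Ax; apply/neighborsP; exists x.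
have Nx : y \in A -> x \in neighbors e A.
  by move=> Ay; apply/neighborsP; exists y; rewrite // e_sym.
case: (boolP (x \in A)) => Ax; case: (boolP (y \in A)) => Ay //.
- by case/negP: (indA _ _ Ax Ay).
- by rewrite Ny // addn1.
by rewrite Nx.
Qed.

(** By degree, z m is exactly a product of t edges, and z does not contribute to
the degree in N(A). *)
Lemma wdeg_neighbors_edge_multiple A t z m : independent e A ->
  (mdeg m).+1 <= 2 * t -> edge_multiple t (U_(z) + m)%MM ->
  z \notin neighbors e A -> wdeg A m <= wdeg (neighbors e A) m.
Proof.
move=> indA deg_m em nNz.
have [|s es Es] := edge_multiple_exact _ em; first by rewrite mdegD mdeg1.
have := wdeg_edge_sum_neighbors indA es.
rewrite -Es !wdegD !wdeg1 (negbTE nNz); exact/leq_trans/leq_addl.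
Qed.

Hypothesis (e_nbr : forall x, exists y, e x y).

(** The combinatorial half of the lower bound on t. Here X is the set of vertices
outside C that divide m. The degree of m in X is t and its degree in C is less,
whereas [wdeg_neighbors_edge_multiple] bounds the degree in a subset A of X by
the degree in N(A) as soon as some z in C lies outside N(A). Such a z exists for
A = X if N(X) is not a cover, and for both parts of X if X splits. *)
Lemma dominating_of_witness C t m : vertex_cover e C ->
  0 < t -> (exists z, z \in C) -> mdeg m < 2 * t -> wdeg C m < t ->
  (forall z, z \in C -> edge_multiple t (U_(z) + m)%MM) ->
  independent e (~: C) ->
  exists X, [/\ #|X| <= t, independent e X,
    connected (induced (square e) (X:=X)) & vertex_cover e (neighbors e X)].
Proof.
move=> covC t_gt0 [z0 Cz0] deg_m degC em indC.
pose X := [set x in ~: C | m x != 0]; exists X.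
have sXC : X \subset ~: C by apply/subsetP=> x; rewrite inE => /andP[].
have indX : independent e X by move=> x y /(subsetP sXC) xC /(subsetP sXC); apply: indC.
have sub_ind A : A \subset X -> independent e A.
  by move=> /subsetP sAX x y /sAX Xx /sAX; apply: indX.
have NC A : A \subset X -> neighbors e A \subset C.
  move=> sAX; apply/subsetP=> y /neighborsP[x Ax exy].
  case/orP: (covC _ _ exy) => // Cx.
  by have := subsetP sXC _ (subsetP sAX _ Ax); rewrite inE Cx.
have degX : wdeg X m = t.
  have -> : wdeg X m = wdeg (~: C) m.
    rewrite /wdeg big_mkcond [RHS]big_mkcond; apply: eq_bigr => x _.
    by rewrite inE; case: eqP => [->|_]; rewrite ?andbT ?andbF ?if_same.
  have := edge_multiple_mdeg (em _ Cz0).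
  have := edge_multiple_wdeg covC (em _ Cz0).
  move: deg_m; rewrite wdegD wdeg1 Cz0 mdegD mdeg1 (wdegT m C).
  lia.
have hall A z : A \subset X -> z \in C -> z \notin neighbors e A ->
    wdeg A m <= wdeg (neighbors e A) m.
  move=> sAX Cz; apply: wdeg_neighbors_edge_multiple (em _ Cz) => //.
  exact: sub_ind.
split=> //.
- rewrite -degX -sum1_card; apply: leq_sum => x.
  by rewrite inE lt0n => /andP[].
- apply/connected_inducedP=> A /properP[sAX [b Xb nAb]] /set0Pn[a Aa].
  apply: contrapT => no_edge; pose B := X :\: A.
  have sBX : B \subset X by apply: subsetDl.
  have dis : [disjoint neighbors e A & neighbors e B].
    apply/pred0P=> y /=; apply/negP=> /andP[].
    case/neighborsP=> u Au euy /neighborsP[v]; rewrite inE => /andP[nAv Xv] evy.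
    apply: no_edge; exists u, v; split=> //; apply/squareP; split.
      by apply: contraNneq nAv => <-.
    by right; exists y => //; rewrite e_sym.
  have [ya eya] := e_nbr a; have [yb eyb] := e_nbr b.
  have Nya : ya \in neighbors e A by apply/neighborsP; exists a.
  have Nyb : yb \in neighbors e B by apply/neighborsP; exists b; rewrite // inE nAb.
  have leA : wdeg A m <= wdeg (neighbors e A) m.
    apply: (hall _ yb) => //; first exact: (subsetP (NC _ sBX)).
    by rewrite (disjointFl dis).
  have leB : wdeg B m <= wdeg (neighbors e B) m.
    apply: (hall _ ya) => //; first exact: (subsetP (NC _ sAX)).
    by rewrite (disjointFr dis).
  have AB : A :|: B = X by rewrite -{1}(setIidPr sAX) setID.
  have: t <= wdeg C m; last by rewrite leqNgt degC.
  rewrite -degX -AB wdegU; last first.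
    by rewrite disjoints_subset; apply/subsetP=> x; rewrite !inE => ->.
  apply: leq_trans (leq_add leA leB) _; rewrite -wdegU //.
  by apply: wdeg_sub; rewrite subUset !NC.
suff CN : C \subset neighbors e X.
  by move=> x y /covC/orP[] /(subsetP CN)->; rewrite ?orbT.
apply/subsetP=> z Cz; apply: contraLR degC => nNz; rewrite -leqNgt -degX.
exact: leq_trans (hall _ _ (subxx _) Cz nNz) (wdeg_sub _ (NC _ (subxx _))).
Qed.

(** The combinatorial half of the upper bound on t, by growing A inside X one
vertex at a time along the square. *)
Lemma witness_of_dominating X j : independent e X ->
  connected (induced (square e) (X:=X)) -> 0 < j <= #|X| ->
  exists A m, [/\ A \subset X, #|A| = j, (mdeg m).+1 = 2 * j,
    (wdeg (neighbors e X) m).+1 = j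
    & forall z, z \in neighbors e A -> edge_multiple j (U_(z) + m)%MM].
Proof.
move=> indX connX /andP[].
have nNX x : x \in X -> x \in neighbors e X = false.
  by move=> Xx; apply/neighborsP=> -[y Xy]; apply/negP/indX.
case: j => // j _; elim: j => [|j IHj] lejX.
  have [x Xx] : exists x, x \in X by apply/set0Pn; rewrite -card_gt0.
  exists [set x], U_(x)%MM; rewrite sub1set cards1 mdeg1 wdeg1 nNX //; split=> //.
  by move=> z /neighborsP[_ /set1P->]; rewrite e_sym; apply: edge_multiple1.
have [A [m [sAX cardA degm degNm em]]] := IHj (ltnW lejX).
have [||x [x' [Ax Xx' nAx' /squareP[_ sq]]]] := (connected_inducedP _ _).1 connX A.
- rewrite properEneq sAX andbT; apply: contraTneq lejX => <-.
  by rewrite cardA ltnn.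
- by rewrite -card_gt0 cardA.
have Xx := subsetP sAX _ Ax.
have [y exy eyx'] : exists2 z, e x z & e z x'.
  by case: sq => // exx'; case/negP: (indX _ _ Xx Xx').
exists (x' |: A), (U_(y) + U_(x') + m)%MM; split.
- by rewrite subUset sub1set Xx'.
- by rewrite cardsU1 nAx' cardA.
- by rewrite !mdegD !mdeg1 -addnS degm -mulnS.
- rewrite !wdegD !wdeg1 (nNX x') // addn0 -addnS degNm.
  by have -> : y \in neighbors e X by apply/neighborsP; exists x.
move=> z /neighborsP[v /setU1P[-> ex'z|Av evz]]; rewrite -(add1n j.+1).
  (* z pairs with the new vertex x', which leaves y to extend m *)
  have -> : (U_(z) + (U_(y) + U_(x') + m) = U_(x') + U_(z) + (U_(y) + m))%MM.
    by apply/mnmP=> i; rewrite !mnmDE; lia.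
  apply: edge_multipleD (edge_multiple1 ex'z) (em y _).
  by apply/neighborsP; exists x.
have -> : (U_(z) + (U_(y) + U_(x') + m) = U_(y) + U_(x') + (U_(z) + m))%MM.
  by apply/mnmP=> i; rewrite !mnmDE; lia.
apply: edge_multipleD (edge_multiple1 eyx') (em z _).
by apply/neighborsP; exists v.
Qed.

End Monomials.

(** * Prime ideals and monomial ideals *)

Section PrimeIdeals.
Import GRing.Theory.
Local Open Scope ring_scope.
Variables (R : comNzRingType) (P : set R).
Hypothesis P_prime : prime_ideal P.

Lemma prime_ideal0 : P 0.
Proof. by have [[/set_mem]] := P_prime. Qed.

Lemma prime_ideal1 : ~ P 1.
Proof. by have [[_ /negP P1 _] _] := P_prime => /mem_set. Qed.

Lemma prime_idealMl a u : P u -> P (a * u).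
Proof.
have [[/set_mem P0 _ Pl] _] := P_prime.
by move=> Pu; rewrite -[_ * _]addr0; apply/set_mem/Pl; apply: mem_set.
Qed.

Lemma prime_idealD u v : P u -> P v -> P (u + v).
Proof.
have [[_ _ Pl] _] := P_prime.
by move=> Pu Pv; rewrite -[u]mul1r; apply/set_mem/Pl; apply: mem_set.
Qed.

Lemma prime_idealM u v : P (u * v) -> P u \/ P v.
Proof.
have [_ Pm] := P_prime.
by move=> Puv; case/orP: (Pm u v (mem_set Puv)) => /set_mem; [left | right].
Qed.

Lemma prime_idealX u j : P (u ^+ j) -> j != 0%N /\ P u.
Proof.
elim: j => [/prime_ideal1//|j IHj]; rewrite exprS => /prime_idealM[//|].
by case/IHj.
Qed.

Lemma prime_ideal_prod (I : Type) (r : seq I) (F : I -> R) :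
  P (\prod_(i <- r) F i) -> exists i, P (F i).
Proof.
elim: r => [|i r IHr]; first by rewrite big_nil => /prime_ideal1.
by rewrite big_cons => /prime_idealM[?|/IHr//]; exists i.
Qed.

End PrimeIdeals.

Section MonomialIdeals.
Import GRing.Theory fintype boot.finset.
Local Open Scope ring_scope.
Variables (k : fieldType) (n : nat).
Implicit Types (p q : {mpoly k[n]}) (m : 'X_{1..n}) (C : {set 'I_n}).

(** When M is closed under multiples, this is the ideal generated by the
monomials in M. *)
Definition mono_ideal (M : 'X_{1..n} -> Prop) : set {mpoly k[n]} :=
  [set p | forall m, m \in msupp p -> M m]%classic.

Lemma mono_ideal0 M : mono_ideal M 0.
Proof. by move=> m; rewrite msupp0. Qed.

Lemma mono_idealD M p q : mono_ideal M p -> mono_ideal M q -> mono_ideal M (p + q).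
Proof.
by move=> Mp Mq m /msuppD_le; rewrite mem_cat => /orP[/Mp|/Mq].
Qed.

Lemma mono_idealM M1 M2 M p q :
  (forall m1 m2, M1 m1 -> M2 m2 -> M (m1 + m2)%MM) ->
  mono_ideal M1 p -> mono_ideal M2 q -> mono_ideal M (p * q).
Proof.
move=> MM Mp Mq m /msuppM_le /allpairsP[[m1 m2] /= [/Mp M1m /Mq M2m ->]].
exact: MM.
Qed.

Lemma mono_idealMl M q p : (forall m1 m2, M m2 -> M (m1 + m2)%MM) ->
  mono_ideal M p -> mono_ideal M (q * p).
Proof.
move=> MM; apply: (@mono_idealM (fun=> True)) => // m1 m2 _; exact: MM.
Qed.

Lemma mono_idealX M m : mono_ideal M 'X_[m] <-> M m.
Proof.
split=> [|Mm m']; first by apply; rewrite msuppX inE.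
by rewrite msuppX inE => /eqP->.
Qed.

Lemma mono_idealMX M p m :
  mono_ideal M (p * 'X_[m]) <-> mono_ideal (fun m' => M (m + m')%MM) p.
Proof.
split=> H m'; last by rewrite (perm_mem (msuppMX _ _)) => /mapP[m1 /H ? ->].
by move=> pm'; apply: H; rewrite (perm_mem (msuppMX _ _)); apply: map_f.
Qed.

Lemma prime_ideal_mono_sub (P : set {mpoly k[n]}) M : prime_ideal P ->
  (forall m, M m -> P 'X_[m]) -> (mono_ideal M `<=` P)%classic.
Proof.
move=> prP MP p Mp; rewrite [p]mpolyE big_seq; apply: big_ind.
- exact: prime_ideal0.
- by move=> *; apply: prime_idealD.
by move=> m /Mp/MP Pm; rewrite -mul_mpolyC; apply: prime_idealMl.
Qed.

Lemma prime_ideal_mpolyX (P : set {mpoly k[n]}) m : prime_ideal P ->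
  P 'X_[m] -> exists2 i, m i != 0%N & P 'X_i.
Proof.
move=> prP; rewrite mpolyXE_id => /(prime_ideal_prod prP)[i].
by case/(prime_idealX prP); exists i.
Qed.

Definition var_ideal C : set {mpoly k[n]} := mono_ideal (fun m => 0 < wdeg C m)%N.

(** The ring morphism with kernel [var_ideal C]; as it maps into an integral
domain, it shows that this ideal is prime. *)
Definition kill_vars C p : {mpoly k[n]} :=
  p \mPo [tuple if i \in C then 0 else 'X_i | i < n].

Lemma mcoeff_kill_vars C p m :
  (kill_vars C p)@_m = if wdeg C m == 0%N then p@_m else 0.
Proof.
have killX m' : kill_vars C 'X_[m'] = if wdeg C m' == 0%N then 'X_[m'] else 0.
  rewrite /kill_vars comp_mpolyX; case: eqP => [/eqP|/eqP].
    rewrite sum_nat_eq0 => /forall_inP C0; rewrite [RHS]mpolyXE_id.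
    apply: eq_bigr => i _; rewrite tnth_mktuple.
    by case: ifP => // /C0/eqP->; rewrite !expr0.
  rewrite -lt0n wdeg_gt0 => /exists_inP[z Cz mz].
  by rewrite (bigD1 z) //= tnth_mktuple Cz expr0n (negbTE mz) mul0r.
rewrite (_ : p@_m = \sum_(m' <- msupp p) (p@_m' *: 'X_[m'])@_m); last first.
  by rewrite -[in RHS]raddf_sum -mpolyE.
rewrite {1}/kill_vars comp_mpolyEX raddf_sum /=.
transitivity (\sum_(m' <- msupp p)
  if wdeg C m == 0%N then (p@_m' *: 'X_[k, m'])@_m else 0).
  apply: eq_bigr => m' _; rewrite -/(kill_vars C _) killX !mcoeffZ mcoeffX.
  case: (eqVneq m' m) => [->|mNm'].
    by case: ifP; rewrite ?mcoeff0 ?mcoeffX ?eqxx ?mulr0.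
  by case: ifP; rewrite ?mcoeffX ?mcoeff0 ?(negbTE mNm') mulr0 if_same.
by case: ifP => // _; apply: big1_eq.
Qed.

Lemma var_idealP C p : var_ideal C p <-> kill_vars C p = 0.
Proof.
split=> [Cp|kp m pm].
  apply/mpolyP=> m; rewrite mcoeff_kill_vars mcoeff0; case: eqP => // C0.
  apply/eqP; rewrite mcoeff_eq0; apply/negP=> /Cp.
  by rewrite C0.
have := congr1 (mcoeff m) kp; rewrite mcoeff_kill_vars mcoeff0 lt0n.
by case: ifP => // _ /eqP; rewrite mcoeff_eq0 pm.
Qed.

Lemma var_ideal_prime C : prime_ideal (var_ideal C).
Proof.
split; first split.
- by apply: mem_set; apply: mono_ideal0.
- apply/negP=> /set_mem/var_idealP; rewrite /kill_vars comp_mpoly1.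
  by move/eqP; rewrite oner_eq0.
- move=> a u v /set_mem Cu /set_mem Cv; apply: mem_set; apply: mono_idealD => //.
  by apply: mono_idealMl Cu => m1 m2; rewrite wdegD; apply: ltn_addl.
move=> u v /set_mem/var_idealP; rewrite /kill_vars rmorphM => /eqP.
by rewrite mulf_eq0 => /orP[]/eqP/var_idealP/mem_set->; rewrite ?orbT.
Qed.

Lemma var_idealX C i : var_ideal C 'X_i <-> i \in C.
Proof. by rewrite /var_ideal mono_idealX wdeg1; case: (i \in C). Qed.

Lemma var_ideal_sub C (P : set {mpoly k[n]}) : prime_ideal P ->
  (forall i, i \in C -> P 'X_i) -> (var_ideal C `<=` P)%classic.
Proof.
move=> prP CP; apply: prime_ideal_mono_sub => // m.
rewrite wdeg_gt0 => /exists_inP[z Cz mz].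
have le_zm : (U_(z) <= m)%MM by rewrite lep1mP.
by rewrite -(submK le_zm) mpolyXD; apply: prime_idealMl => //; apply: CP.
Qed.

End MonomialIdeals.

(** * The edge ideal and its powers *)

Section IdealGen.
Local Open Scope ring_scope.
Import GRing.Theory.
Variables (R : comNzRingType) (A : set R).

Lemma ideal_gen0 : ideal_gen A 0.
Proof.
by exists 0%N, (fun=> 0), (fun=> 0); split=> [[]//|]; rewrite big_ord0.
Qed.

Lemma ideal_genMl c a : A a -> ideal_gen A (c * a).
Proof.
by move=> Aa; exists 1%N, (fun=> c), (fun=> a); split=> //; rewrite big_ord1.
Qed.

Lemma ideal_genD u v : ideal_gen A u -> ideal_gen A v -> ideal_gen A (u + v).
Proof.
move=> [m1 [c1 [a1 [A1 ->]]]] [m2 [c2 [a2 [A2 ->]]]].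
pose glue (f1 : 'I_m1 -> R) (f2 : 'I_m2 -> R) i :=
  match split i with inl j => f1 j | inr j => f2 j end.
exists (m1 + m2)%N, (glue c1 c2), (glue a1 a2); split=> [i|].
  by rewrite /glue; case: (split i).
rewrite big_split_ord; congr (_ + _); apply: eq_bigr => j _.
  by rewrite /glue (unsplitK (inl j)).
by rewrite /glue (unsplitK (inr j)).
Qed.

End IdealGen.

Section EdgeIdeal.
Import GRing.Theory fintype boot.finset.
Local Open Scope ring_scope.
Variables (k : fieldType) (n : nat) (e : rel 'I_n).
Implicit Types (p : {mpoly k[n]}) (m : 'X_{1..n}) (C : {set 'I_n}).

Lemma edge_ideal_mono p : edge_ideal k e p -> mono_ideal (edge_multiple e 1) p.
Proof.
move=> [r [c [a [edge_a ->]]]]; elim/big_ind: _ => [||i _].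
- exact: mono_ideal0.
- by move=> *; apply: mono_idealD.
have [x [y [exy ->]]] := edge_a i.
apply: mono_idealMl => [m1 m2|]; first exact/edge_multiple_le/lem_addl.
by rewrite -mpolyXD mono_idealX; apply: edge_multiple1.
Qed.

Lemma ideal_exp_edgeP t p :
  ideal_exp (edge_ideal k e) t p <-> mono_ideal (edge_multiple e t) p.
Proof.
split=> [[r [c [a [prod_a ->]]]]|Mp].
  elim/big_ind: _ => [||i _].
  - exact: mono_ideal0.
  - by move=> *; apply: mono_idealD.
  have [g Ig ->] := prod_a i.
  apply: mono_idealMl => [m1 m2|]; first exact/edge_multiple_le/lem_addl.
  elim: {prod_a} t g Ig => [|t IHt] g Ig m; first by move=> _; apply: edge_multiple0.
  rewrite big_ord_recl; apply: mono_idealM (edge_ideal_mono (Ig _)) (IHt _ _) _ => //.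
  by move=> m1 m2; rewrite -add1n; apply: edge_multipleD.
rewrite [p]mpolyE big_seq; apply: big_ind => [||m /Mp[s [<- es le_sm]]].
- exact: ideal_gen0.
- exact: ideal_genD.
rewrite -(submK le_sm) mpolyXD scalerAl; apply: ideal_genMl.
exists (fun j => let q := tnth (in_tuple s) j in 'X_(q.1) * 'X_(q.2)).
  move=> j; rewrite -[X in edge_ideal _ _ X]mul1r; apply: ideal_genMl.
  by eexists _, _; split=> //; apply: (allP es); apply: mem_tnth.
rewrite -(big_tnth _ _ s xpredT (fun q => 'X_(q.1) * 'X_(q.2))).
rewrite /edge_sum (big_morph _ (@mpolyXD n k) (mpolyX0 n k)).
by apply: eq_bigr => q _; rewrite mpolyXD.
Qed.

Hypotheses (e_sym : ssrbool.symmetric e) (e_irr : irreflexive e).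

Lemma edge_ideal_sub_prime P : prime_ideal P ->
  (edge_ideal k e `<=` P)%classic <-> forall i j, e i j -> P 'X_i \/ P 'X_j.
Proof.
move=> prP; split=> [sIP i j eij|edgeP].
  apply: (prime_idealM prP); apply: sIP.
  by rewrite -['X_i * 'X_j]mul1r; apply: ideal_genMl; exists i, j.
move=> _ [r [c [a [edge_a ->]]]]; elim/big_ind: _ => [||i _].
- exact: prime_ideal0.
- exact: prime_idealD.
apply: prime_idealMl => //; have [x [y [/edgeP Pxy ->]]] := edge_a i.
by case: Pxy => [Px|Py]; [rewrite mulrC|]; apply: prime_idealMl.
Qed.

Lemma var_ideal_minimal C : vertex_cover e C ->
  (forall z, z \in C -> exists2 x, x \notin C & e z x) ->
  minimal_prime (edge_ideal k e) (var_ideal C).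
Proof.
move=> covC Cmin; split; first exact: var_ideal_prime.
  apply/edge_ideal_sub_prime; first exact: var_ideal_prime.
  by move=> i j /covC/orP[] ?; [left|right]; apply/var_idealX.
move=> Q prQ /(edge_ideal_sub_prime prQ) edgeQ sQC; apply/seteqP; split=> //.
apply: var_ideal_sub => // z /Cmin[x nCx /edgeQ[//|/sQC/var_idealX Cx]].
by rewrite Cx in nCx.
Qed.

(** If all neighbors of z were in C, the variables of C other than z would still
form a cover and generate a smaller prime containing the edge ideal. *)
Lemma minimal_prime_cover P : minimal_prime (edge_ideal k e) P ->
  let C := [set i | `[< P 'X_i >]] in
  vertex_cover e C /\ forall z, z \in C -> exists2 x, x \notin C & e z x.
Proof.
move=> [prP /(edge_ideal_sub_prime prP) edgeP minP] C.
have inC i : (i \in C) = `[< P 'X_i >] by rewrite inE.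
have covC : vertex_cover e C.
  by move=> x y /edgeP; rewrite !inC => -[]/asboolT->; rewrite ?orbT.
split=> // z Cz; apply: contrapT => noNz.
have : ~ var_ideal (C :\ z) ('X_z : {mpoly k[n]}) by rewrite var_idealX !inE eqxx.
rewrite (minP (var_ideal (C :\ z))) => [|||].
- by move: Cz; rewrite inC => /asboolP.
- exact: var_ideal_prime.
- apply/edge_ideal_sub_prime; first exact: var_ideal_prime.
  have case_edge i j : i \in C -> e i j -> i \in C :\ z \/ j \in C :\ z.
    move=> Ci eij; have [iz|] := eqVneq i z; last first.
      by rewrite !in_setD1 Ci andbT => ->; left.
    rewrite iz in eij; right; rewrite in_setD1.
    have -> : j != z by apply: contraTneq eij => ->; rewrite e_irr.
    by apply: contrapT => /negP nCj; apply: noNz; exists j => //; rewrite inE.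
  move=> i j eij; rewrite !var_idealX; case/orP: (covC _ _ eij).
    by move/case_edge; apply.
  by move/case_edge => /(_ i); rewrite e_sym => /(_ eij)[]; [right|left].
by apply: var_ideal_sub => // i; rewrite !inE => /andP[_ /asboolP].
Qed.

End EdgeIdeal.

(** * The v-number of a power of the edge ideal *)

Section Vnumbers.
Import GRing.Theory fintype boot.finset.
Local Open Scope ring_scope.
Variables (k : fieldType) (n : nat) (e : rel 'I_n).
Hypotheses (e_sym : ssrbool.symmetric e) (e_irr : irreflexive e).
Hypothesis e_edge : exists i j : 'I_n, e i j.
Implicit Types (f : {mpoly k[n]}) (C : {set 'I_n}).

Lemma connected_neighbor : connected e -> forall x, exists y, e x y.
Proof.
move=> e_conn x; have [i [j eij]] := e_edge.
have [y yNx] : exists y, y != x.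
  have [ix|] := eqVneq i x; last by exists i.
  by exists j; rewrite -ix; apply: contraTneq eij => ->; rewrite e_irr.
have [||u [v [euv /eqP <- _]]] := @connect_cut _ e (pred1 x) x y (e_conn x y).
- exact: eqxx.
- exact: yNx.
by exists v.
Qed.

Lemma colon_degree_ge P f t i : colon (ideal_exp (edge_ideal k e) t) f = P ->
  P 'X_i -> f != 0 -> (2 * t <= msize f)%N.
Proof.
move=> <- /ideal_exp_edgeP; rewrite mulrC mono_idealMX => em.
rewrite -msupp_eq0; case def_f: (msupp f) => [//|m r] _.
have fm : m \in msupp f by rewrite def_f inE eqxx.
apply: leq_trans (msize_mdeg_lt fm).
by have := edge_multiple_mdeg (em _ fm); rewrite mdegD mdeg1.
Qed.

(** If every monomial of f had t factors in C, the t-th power u of the product of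
all variables outside C would multiply f into I^t: in each monomial, t factors
in C are paired with neighbors outside C. But the prime P contains no variable
outside C, hence not u. *)
Lemma colon_small_cover_degree P f t C : prime_ideal P ->
  colon (ideal_exp (edge_ideal k e) t) f = P ->
  (forall i, P 'X_i -> i \in C) ->
  (forall z, z \in C -> exists2 x, x \notin C & e z x) ->
  exists2 m, m \in msupp f & (wdeg C m < t)%N.
Proof.
move=> prP colonP PC nbrC; apply: contrapT => no_m.
have degC m : m \in msupp f -> (t <= wdeg C m)%N.
  by move=> fm; rewrite leqNgt; apply/negP=> lt_m; apply: no_m; exists m.
pose u : 'X_{1..n} := [multinom (if i \in C then 0 else t)%N | i < n].
suff Pu : P 'X_[u].
  have [i] := prime_ideal_mpolyX prP Pu; rewrite mnmE.
  by case: ifPn => // nCi _ /PC Ci; rewrite Ci in nCi.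
rewrite -colonP; apply/ideal_exp_edgeP; rewrite mulrC mono_idealMX => m /degC.
(* The exponent of u must grow with the number j of edges already chosen. *)
suff mult j : (j <= t)%N -> (j <= wdeg C m)%N ->
    edge_multiple e j ([multinom (if i \in C then 0 else j)%N | i < n] + m)%MM.
  exact: mult.
elim: j m {degC} => [|j IHj] m lejt lejm; first exact: edge_multiple0.
have : (0 < wdeg C m)%N by apply: leq_trans lejm.
rewrite wdeg_gt0 => /exists_inP[z Cz]; rewrite -lep1mP => le_zm.
have [x nCx ezx] := nbrC z Cz.
have em := edge_multipleD (edge_multiple1 ezx) (IHj (m - U_(z))%MM (ltnW lejt) _).
rewrite -add1n; apply: edge_multiple_le (em _).
  apply/mnm_lepP=> i; rewrite !mnmDE mnmBE !mnm1E !mnmE.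
  have := mnm_lepP le_zm i; rewrite mnm1E.
  case: (eqVneq x i) => [<-|_]; first by rewrite (negbTE nCx); lia.
  by case: ifP; lia.
by move: lejm; rewrite -{1}(submK le_zm) wdegD wdeg1 Cz addn1.
Qed.

Lemma small_kappa_of_vnumber (P : set {mpoly k[n]}) t : connected e ->
  (1 <= t)%N -> minimal_prime (edge_ideal k e) P ->
  is_vnumber P (ideal_exp (edge_ideal k e) t) (2 * t - 1)%N ->
  exists X : {set 'I_n}, [/\ (#|X| <= t)%N, independent e X,
    connected (induced (square e) (X:=X)) & vertex_cover e (neighbors e X)].
Proof.
move=> e_conn t_gt0 minP [[f size_f colonP] _].
have [covC nbrC] := minimal_prime_cover e_sym e_irr minP; case: minP => prP _ _.
set C := [set i | _] in covC nbrC.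
have inC i : (i \in C) = `[< P 'X_i >] by rewrite inE.
have [|m fm degC] := colon_small_cover_degree prP colonP _ nbrC.
  by move=> i Pi; rewrite inC; apply/asboolP.
apply: (dominating_of_witness e_sym (connected_neighbor e_conn) covC t_gt0 _ _ degC).
- have [i [j /covC/orP[]]] := e_edge; first by exists i.
  by exists j.
- by apply: leq_trans (msize_mdeg_lt fm) _; rewrite size_f; lia.
- move=> z; rewrite inC => /asboolP; rewrite -colonP => /ideal_exp_edgeP.
  by rewrite mulrC mono_idealMX; apply.
move=> x y; rewrite !inE => nPx nPy; apply/negP=> /covC.
by rewrite !inE (negbTE nPx) (negbTE nPy).
Qed.

Lemma vnumber_of_dominating (X : {set 'I_n}) : independent e X ->
  connected (induced (square e) (X:=X)) -> vertex_cover e (neighbors e X) ->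
  (0 < #|X|)%N /\ exists P : set {mpoly k[n]},
    minimal_prime (edge_ideal k e) P /\
    is_vnumber P (ideal_exp (edge_ideal k e) #|X|) (2 * #|X| - 1)%N.
Proof.
move=> indX connX covN; set C := neighbors e X in covN.
have [z Cz] : exists z, z \in C.
  have [i [j /covN/orP[]]] := e_edge; first by exists i.
  by exists j.
have X_gt0 : (0 < #|X|)%N.
  by have [x Xx _] := neighborsP _ _ _ Cz; apply/card_gt0P; exists x.
split=> //; exists (var_ideal C); split.
  apply: var_ideal_minimal => // y /neighborsP[x Xx exy]; exists x.
    by apply/neighborsP=> -[x' Xx']; apply/negP/indX.
  by rewrite e_sym.
have [|A [m [sAX cardA degm degC em]]] :=
  witness_of_dominating e_sym indX connX (j := #|X|).
  by rewrite X_gt0 leqnn.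
have AX : A = X by apply/eqP; rewrite eqEcard sAX cardA leqnn.
rewrite {}AX {sAX cardA} in em.
split=> [|j [f size_f colon_f]]; last first.
  have : (2 * #|X| <= msize f)%N.
    apply: (colon_degree_ge colon_f (i := z)); first exact/var_idealX.
    by rewrite -msize_poly_eq0 size_f.
  by rewrite size_f; lia.
exists 'X_[m]; first by rewrite msizeX; lia.
apply/seteqP; split=> g.
  move/ideal_exp_edgeP/mono_idealMX => Mg m' /Mg/(edge_multiple_wdeg covN).
  by rewrite wdegD -{1}degC -addn1 leq_add2l.
move=> Cg; apply/ideal_exp_edgeP/mono_idealMX => m' /Cg.
rewrite wdeg_gt0 => /exists_inP[y Cy]; rewrite -lep1mP => le_ym.
apply: edge_multiple_le (em y Cy); apply/mnm_lepP=> i; rewrite !mnmDE addnC.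
by rewrite leq_add2l; apply/mnm_lepP.
Qed.

End Vnumbers.

Lemma ex_is_min (B : set nat) : (exists j, B j) -> exists j, is_min B j.
Proof.
move=> [j0 Bj0]; have ex : exists j, `[< B j >] by exists j0; apply/asboolP.
case: (ex_minnP ex) => j /asboolP Bj minj; exists j; split=> // i Bi.
exact/minj/asboolP.
Qed.

Local Open Scope classical_set_scope.

Theorem mainTheorem3 (k : fieldType) (n : nat) (e : rel 'I_n)
    (e_sym : ssrbool.symmetric e) (e_irr : irreflexive e)
    (e_conn : connected e) (e_edge : exists i j : 'I_n, e i j) :
  exists m : nat,
    is_min [set t : nat | (1 <= t)%N /\
              exists P : set {mpoly k[n]},
                minimal_prime (edge_ideal k e) P /\
                is_vnumber P (ideal_exp (edge_ideal k e) t) (2 * t - 1)%N] m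
    /\ is_kappa e m.
Proof.
have [X0 [ind0 conn0 cov0]] := exists_connected_dominating e_sym e_irr e_conn e_edge.
have [|m kappa_m] := @ex_is_min [set j | exists X : {set 'I_n},
  [/\ #|X| = j, independent e X, connected (induced (square e) (X:=X))
    & vertex_cover e (neighbors e X)]]; first by exists #|X0|, X0.
exists m; split=> //; have [[X [cardX indX connX covX]] min_m] := kappa_m.
split; first by rewrite -cardX; apply: vnumber_of_dominating.
move=> t [t_gt0 [P [minP vP]]].
have [X' [leX' indX' connX' covX']] :=
  small_kappa_of_vnumber e_sym e_irr e_edge e_conn t_gt0 minP vP.
by apply: leq_trans leX'; apply: min_m; exists X'.
Qed.
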